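(* Suppose $G$ is a closed subset of $[0,1]\times[0,1]$, $\mathbf{G}=\star_{i=1}^\infty G\neq\emptyset$, and $\sigma(\mathbf{G})=\mathbf{G}$. Then $\operatorname{ent}(G)=h(\sigma)$, where $h(\sigma)$ is the topological entropy of the shift map $\sigma:\mathbf{G}\to\mathbf{G}$.
   Context: Let $I=[0,1]$; open intervals in $I$ are open relative to $I$. A minimal open cover of $I$ by open intervals is a finite collection $\alpha=\{\alpha_1,\dots,\alpha_n\}$ of open intervals covering $I$ such that no subcollection of smaller cardinality covers $I$. For a closed set $A\subset I\times I$ and a positive integer $m$, let $\star_{i=1}^m A=\{(x_0,\dots,x_m)\in I^{m+1}:(x_{i-1},x_i)\in A\text{ for }1\le i\le m\}$ and $\mathbf{A}=\star_{i=1}^\infty A=\{(x_0,x_1,\dots)\in I^\infty:(x_{i-1},x_i)\in A\text{ for all }i\ge1\}$, a closed subset of $I^\infty$ with the product topology. Let $\alpha^{m+1}=\{\alpha_{k_0}\times\cdots\times\alpha_{k_m}: k_j\in\{1,\dots,n\}\}$, and let $N(K,\mathcal U)$ be the least cardinality of a subcollection of $\mathcal U$ covering $K$. If $\mathbf{A}\neq\emptyset$, define $\operatorname{ent}(A,\alpha)=\lim_{m\to\infty}\frac1m\log N(\star_{i=1}^mA,\alpha^{m+1})$ (the limit exists); if $\mathbf{A}=\emptyset$, define $\operatorname{ent}(A,\alpha)=0$. Finally $\operatorname{ent}(A)=\sup_\alpha\operatorname{ent}(A,\alpha)\in[0,\infty]$, over all minimal open covers $\alpha$ of $I$ by open intervals.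 The shift map is $\sigma(x_0,x_1,x_2,\dots)=(x_1,x_2,\dots)$. For a continuous self-map $T$ of a compact space $X$ and an open cover $\mathcal V$ of $X$, $h(T,\mathcal V)=\lim_{n\to\infty}\frac1n\log N\big(X,\bigvee_{i=0}^nT^{-i}\mathcal V\big)$, where $\bigvee$ denotes the join of covers (all intersections of one member from each), and $h(T)=\sup_{\mathcal V}h(T,\mathcal V)$ over all open covers $\mathcal V$ of $X$ (Adler–Konheim–McAndrew entropy). *)

(* Defs.v *)
From HB Require Import structures.
From mathcomp Require Import all_boot all_order all_algebra.
From mathcomp Require Import all_classical all_reals all_analysis.

Set Implicit Arguments.
Unset Strict Implicit.
Unset Printing Implicit Defensive.

Import Order.TTheory GRing.Theory Num.Theory.
Import numFieldNormedType.Exports.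

Local Open Scope classical_set_scope.
Local Open Scope card_scope.
Local Open Scope ring_scope.

Section CoveringNumber.
Variables (T : Type) (K : set T).
Implicit Type U : set (set T).

Definition covers U := K `<=` \bigcup_(V in U) V.

Definition coverable_by U (n : nat) :=
  exists W : set (set T), [/\ W `<=` U, W #= `I_n & covers W].

(* The value 0 is a dummy when no finite subcollection of [U] covers [K]; this
   does not happen for the open covers of compact sets considered below. *)
Definition covnum U : nat :=
  xget 0%N
    [set n | coverable_by U n /\ forall k, coverable_by U k -> (n <= k)%N].

End CoveringNumber.

(* Adler-Konheim-McAndrew entropy; meaningful for [X] compact, [f] continuous. *)
Section TopologicalEntropy.
Variables (R : realType) (X : topologicalType) (f : X -> X).
Implicit Type V : set (set X).

Definition open_cover V := V `<=` open /\ covers setT V.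

Definition pullback (i : nat) V : set (set X) := [set iter i f @^-1` U | U in V].

Definition join_upto (n : nat) (W : nat -> set (set X)) : set (set X) :=
  [set \bigcap_(i in `I_n.+1) U i
     | U in [set U : nat -> set X | forall i, (i <= n)%N -> W i (U i)]].

Definition cover_entropy V : R :=
  limn (fun n : nat =>
    n%:R^-1 * ln (covnum setT (join_upto n (pullback^~ V)))%:R).

Definition top_entropy : \bar R :=
  ereal_sup [set (cover_entropy V)%:E | V in open_cover].

End TopologicalEntropy.

Section ClosedRelation.
Variable R : realType.
Local Notation I := (`[0, 1]%classic : set R).

Definition open_interval_in_I (U : set R) :=
  is_interval U /\ exists2 O : set R, open O & U = O `&` I.

(* For finite [a], the condition [~~ (a #<= b)] says that [b] has strictly
   smaller cardinality than [a]. *)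
Definition minimal_interval_cover (a : set (set R)) :=
  [/\ finite_set a,
      a `<=` open_interval_in_I,
      covers I a &
      forall b, b `<=` a -> ~~ (a #<= b) -> ~ covers I b].

Variable A : set (R * R).

Definition star (m : nat) : set ('I_m.+1 -> R) :=
  [set x | (forall j, I (x j)) /\
           forall i : 'I_m, A (x (widen_ord (leqnSn m) i), x (lift ord0 i))].
Arguments star : clear implicits.

Definition star_infty : set {ptws nat -> R} :=
  [set x | (forall j, I (x j)) /\ forall i, A (x i, x i.+1)].

Definition boxes (a : set (set R)) (m : nat) : set (set ('I_m.+1 -> R)) :=
  [set [set x | forall j, k j (x j)]
     | k in [set k : 'I_m.+1 -> set R | forall j, a (k j)]].
Arguments boxes : clear implicits.

Definition ent_cover (a : set (set R)) : R :=
  if star_infty == set0 then 0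
  else limn (fun m : nat => m%:R^-1 * ln (covnum (star m) (boxes a m))%:R).

Definition ent : \bar R :=
  ereal_sup [set (ent_cover a)%:E | a in minimal_interval_cover].

Definition seq_shift (x : {ptws nat -> R}) : {ptws nat -> R} := fun i => x i.+1.

Lemma seq_shift_star_infty x : star_infty x -> star_infty (seq_shift x).
Proof. by case=> xI xA; split=> i; [exact: xI | exact: xA]. Qed.

(* The shift on the subtype [set_type star_infty], which carries the topology
   induced by the product topology. *)
Definition shift_map (x : star_infty) : star_infty :=
  SigSub (mem_set (seq_shift_star_infty (set_valP x))).

End ClosedRelation.

Arguments star {R} A m _.
Arguments boxes {R} a m _.
Arguments star_infty {R} A _.
Arguments seq_shift {R} x _.
Arguments shift_map {R} A x.

(* Main.v *)
Require Import Defs.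
From HB Require Import structures.
From mathcomp Require Import all_boot all_order all_algebra.
From mathcomp Require Import all_classical all_reals all_analysis.
From mathcomp Require Import lra.
Import Order.TTheory GRing.Theory Num.Theory.
Import numFieldNormedType.Exports.
Local Open Scope classical_set_scope.
Local Open Scope ring_scope.

(** The two entropies count different objects: [ent G] counts boxes needed for
    the finite words [(x_0, ..., x_m)] allowed by [G], while [top_entropy]
    counts cylinders needed for the infinite sequences in [star_infty G].  A
    finite word may run into a dead end and extend to no infinite sequence, so
    the finite words can need more boxes.  The proof shows that this excess
    does not affect exponential growth.

    Finite words are replaced by [star_prefix G m], the set of sequences in
    [[0, 1]] whose first [m] transitions lie in [G].  These sets decrease to
    [star_infty G], so by compactness of the cube every neighbourhood of
    [star_infty G] contains one of them ([star_prefix_sub_nbhs]).  Fix [L] and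
    cover [star_infty G] by as few cylinders over the coordinates [0..L] as
    possible, say by [b_L] of them.  Their union contains [star_prefix G k] for
    some [k]; hence, in any word with at least [k] transitions, the first
    [L + 1] letters already lie in one of these [b_L] boxes.  Cutting off these
    letters gives, for the number [a_m] of boxes needed for words of [m]
    transitions, [a_(m + L + 1) <= b_L * a_m] for [m >= k]
    ([covnum_star_prefix_split]).  Since also [b_m <= a_m], the argument of
    Fekete's lemma shows that [ln a_m / m] and [ln b_m / m] converge to the same
    limit, the infimum of [ln b_L / (L + 1)] ([subadditive_rates]).  Thus the
    entropy of [G] relative to a cover [a] of the interval is the entropy of the
    shift relative to the open cover that [a] induces through the first
    coordinate ([ent_cover_eq]).

    It remains to see that these induced covers suffice to compute
    [top_entropy].  A Lebesgue number argument ([lebesgue_box]) shows that,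
    given an open cover [V] of [star_infty G], if the intervals of [a] are short
    enough then the cylinders of [a] over the first [n + 1] coordinates refine
    [V] for a suitable [n].  These cylinders form a join of finitely many
    pullbacks of the induced cover, and passing to such a join does not change
    the growth rate ([le_cover_entropy]). *)

Set Implicit Arguments.
Unset Strict Implicit.
Unset Printing Implicit Defensive.

(** * Covering numbers *)

Section CountingCovers.

(** Unlike [coverable_by], this allows repeated members, so that covers can be
    transported and multiplied without tracking which members coincide; both
    notions have the same least [n] (see [covnumP]). *)
Definition covered_by T (K : set T) (U : set (set T)) (n : nat) :=
  exists2 f : nat -> set T, (forall i, (i < n)%N -> U (f i)) &
    K `<=` \bigcup_(i in `I_n) f i.

Lemma coverable_covered T (K : set T) U n : coverable_by K U n -> covered_by K U n.
Proof.
move=> [W [WU /card_esym/card_set_bijP[f [fW _ fsurj]] KW]]; exists f.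
  by move=> i ilt; apply: WU; exact: fW.
by move=> x /KW [V WV Vx]; have [i /= ilt iV] := fsurj _ WV; exists i; rewrite // iV.
Qed.

Lemma covered_coverable T (K : set T) U n :
  covered_by K U n -> exists2 k, (k <= n)%N & coverable_by K U k.
Proof.
move=> [f fU Kf].
have /finite_setP[k fk] : finite_set (f @` `I_n) by exact: finite_image.
exists k.
  by rewrite -card_le_II -(card_le_eql fk) card_image_le.
exists (f @` `I_n); split => //; first by move=> _ [i ilt <-]; exact: fU.
by move=> x /Kf [i ilt fx]; exists (f i) => //; exists i.
Qed.

Lemma covnumP T (K : set T) U n : covered_by K U n ->
  covered_by K U (covnum K U) /\ (covnum K U <= n)%N.
Proof.
move=> /covered_coverable[k kn Uk].
have ex : exists i, `[< coverable_by K U i >] by exists k; exact/asboolP.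
have [|covU le_cov] := @xgetPex _ 0%N [set i | coverable_by K U i /\
    forall j, coverable_by K U j -> (i <= j)%N].
  case: (ex_minnP ex) => i /asboolP Ui imin; exists i; split => // j Uj.
  by apply: imin; exact/asboolP.
split; first exact: coverable_covered.
exact: leq_trans (le_cov _ Uk) kn.
Qed.

(** A cover can be pulled back along [phi]: it is enough that the preimage of
    each of its members is trapped, within [K], in a member of [U].  With
    [phi := id] this is refinement; the map allows comparison of covers living
    on different spaces. *)
Lemma covered_by_refine T T' (phi : T -> T') (K : set T) (K' : set T') U U' n :
    (forall x, K x -> K' (phi x)) ->
    (forall W', U' W' -> exists2 W, U W & K `&` phi @^-1` W' `<=` W) ->
  covered_by K' U' n -> covered_by K U n.
Proof.
move=> phiK refine [f fU' Kf].
have /choice[g gP] : forall i, exists W, (i < n)%N ->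
    U W /\ K `&` phi @^-1` f i `<=` W.
  move=> i; case: (ltnP i n) => ilt; last by exists set0.
  by have [W UW fW] := refine _ (fU' i ilt); exists W.
exists g; first by move=> i /gP[].
by move=> x Kx; have [i ilt fx] := Kf _ (phiK _ Kx); exists i => //;
  apply: (gP i ilt).2.
Qed.

Lemma covnum_refine T T' (phi : T -> T') (K : set T) (K' : set T') U U' n :
    covered_by K' U' n ->
    (forall x, K x -> K' (phi x)) ->
    (forall W', U' W' -> exists2 W, U W & K `&` phi @^-1` W' `<=` W) ->
  (covnum K U <= covnum K' U')%N.
Proof.
move=> /covnumP[covU' _] phiK refine.
exact: (covnumP (covered_by_refine phiK refine covU')).2.
Qed.

(** Each pair of members of the two covers gives one member of [U], namely one
    containing the intersection of their preimages. *)
Lemma covered_by_mul T T1 T2 (phi1 : T -> T1) (phi2 : T -> T2)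
    (K : set T) (K1 : set T1) (K2 : set T2) U U1 U2 n1 n2 :
    (forall x, K x -> K1 (phi1 x)) -> (forall x, K x -> K2 (phi2 x)) ->
    (forall W1 W2, U1 W1 -> U2 W2 ->
      exists2 W, U W & phi1 @^-1` W1 `&` phi2 @^-1` W2 `<=` W) ->
  covered_by K1 U1 n1 -> covered_by K2 U2 n2 -> covered_by K U (n1 * n2).
Proof.
move=> phiK1 phiK2 join [f1 fU1 Kf1] [f2 fU2 Kf2].
case: (posnP n2) => [n20|n2gt0].
  exists (fun=> set0) => [i|x /phiK2/Kf2[i]]; first by rewrite n20 muln0.
  by rewrite /= n20.
have /choice[g gP] : forall i, exists W, (i < n1 * n2)%N -> U W /\
    phi1 @^-1` f1 (i %/ n2)%N `&` phi2 @^-1` f2 (i %% n2)%N `<=` W.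
  (* the pair [(i, j)] is encoded as [i * n2 + j] *)
  move=> i; case: (ltnP i (n1 * n2)) => ilt; last by exists set0.
  have [||W UW fW] := join (f1 (i %/ n2)%N) (f2 (i %% n2)%N).
  - by apply: fU1; rewrite ltn_divLR.
  - by apply: fU2; rewrite ltn_mod.
  - by exists W.
exists g; first by move=> i /gP[].
move=> x Kx; have [i /= ilt fx] := Kf1 _ (phiK1 _ Kx).
have [j /= jlt gx] := Kf2 _ (phiK2 _ Kx).
have ijlt : (i * n2 + j < n1 * n2)%N.
  apply: (@leq_trans (i.+1 * n2)%N); first by rewrite mulSnr ltn_add2l.
  by rewrite leq_mul2r ilt orbT.
exists (i * n2 + j)%N => //; apply: (gP _ ijlt).2.
by rewrite divnMDl// divn_small// addn0 modnMDl modn_small.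
Qed.

Lemma covnum_mul T T1 T2 (phi1 : T -> T1) (phi2 : T -> T2)
    (K : set T) (K1 : set T1) (K2 : set T2) U U1 U2 n1 n2 :
    covered_by K1 U1 n1 -> covered_by K2 U2 n2 ->
    (forall x, K x -> K1 (phi1 x)) -> (forall x, K x -> K2 (phi2 x)) ->
    (forall W1 W2, U1 W1 -> U2 W2 ->
      exists2 W, U W & phi1 @^-1` W1 `&` phi2 @^-1` W2 `<=` W) ->
  (covnum K U <= covnum K1 U1 * covnum K2 U2)%N.
Proof.
move=> /covnumP[cov1 _] /covnumP[cov2 _] phiK1 phiK2 join.
exact: (covnumP (covered_by_mul phiK1 phiK2 join cov1 cov2)).2.
Qed.

End CountingCovers.

(** * Growth rates of almost subadditive sequences *)

Section GrowthRates.
Variable R : realType.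

Lemma ln_nat_ge0 (n : nat) : 0 <= ln n%:R :> R.
Proof.
by case: n => [|n]; [rewrite ln0|rewrite ln_ge0// ler1n].
Qed.

Lemma ler_ln_nat (m n : nat) : (m <= n)%N -> ln m%:R <= ln n%:R :> R.
Proof.
case: m => [|m] mn; first by rewrite (@ln0 _ 0)// ln_nat_ge0.
by rewrite ler_ln ?posrE ?ltr0n ?ler_nat//; exact: leq_trans mn.
Qed.

(** Covering numbers of empty sets are allowed, since [ln 0 = 0]. *)
Lemma ln_natM_le (m n : nat) : ln (m * n)%:R <= ln m%:R + ln n%:R :> R.
Proof.
case: m => [|m]; first by rewrite mul0n (@ln0 _ 0)// add0r ln_nat_ge0.
case: n => [|n]; first by rewrite muln0 (@ln0 _ 0)// addr0 ln_nat_ge0.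
by rewrite natrM lnM ?posrE ?ltr0n.
Qed.

(** The index can be lowered by [L + 1] at the cost [B L] until it is less
    than [k + L + 1]; the constant bounds [A] below that index. *)
Lemma subadditive_bound (A B : nat -> R) L k : 0 <= B L ->
    (forall m, (k <= m)%N -> A (m + L.+1)%N <= B L + A m) ->
  exists C, forall m, A m <= m%:R * (B L / L.+1%:R) + C.
Proof.
move=> BL0 Asub; exists (\sum_(i < (k + L.+1)%N) `|A i|).
elim/ltn_ind => m IH; case: (ltnP m (k + L.+1)) => mk.
  rewrite -[leLHS]add0r lerD ?mulr_ge0 ?divr_ge0//.
  rewrite (bigD1 (Ordinal mk))//= (le_trans (ler_norm _))// lerDl.
  exact: sumr_ge0.
have Lm : (L.+1 <= m)%N := leq_trans (leq_addl k L.+1) mk.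
have km : (k <= m - L.+1)%N by rewrite -(leq_add2r L.+1) subnK.
have := Asub _ km; rewrite subnK// => /le_trans; apply.
have mlt : (m - L.+1 < m)%N by rewrite ltn_subrL ltn0Sn (leq_trans _ Lm).
apply: le_trans (lerD (lexx _) (IH _ mlt)) _.
rewrite addrA lerD2r natrB// mulrBl [L.+1%:R * _]mulrC divfK ?pnatr_eq0//.
by rewrite addrC subrK.
Qed.

(** A two-sequence form of Fekete's lemma.  The common limit is the infimum of
    [B L / (L + 1)]: it bounds [B n / n] from below for every [n > 0], and
    [subadditive_bound] bounds [A n / n] from above by each [B L / (L + 1)] up
    to an error [C / n]. *)
Lemma subadditive_rates (A B : nat -> R) :
    (forall n, 0 <= B n) -> (forall n, B n <= A n) ->
    (forall L, exists k, forall m, (k <= m)%N -> A (m + L.+1)%N <= B L + A m) ->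
  exists c : R, ((fun n => n%:R^-1 * A n) @ \oo --> c) /\
                ((fun n => n%:R^-1 * B n) @ \oo --> c).
Proof.
move=> B0 BA Asub; pose rates := range (fun L => B L / L.+1%:R).
have rates0 : lbound rates 0 by move=> _ [L _ <-]; rewrite divr_ge0.
have c0 : 0 <= inf rates by apply: lb_le_inf => //; exists (B 0%N / 1%:R), 0%N.
have has_inf_rates : has_inf rates.
  by split; [exists (B 0%N / 1%:R), 0%N|exists 0].
have lower n : (0 < n)%N -> inf rates <= n%:R^-1 * B n.
  move=> n0; apply: (@le_trans _ _ (B n / n.+1%:R)).
    by apply: ge_inf; [exists 0|exists n].
  by rewrite mulrC ler_wpM2r// lef_pV2 ?posrE ?ltr0n// ler_nat.
have mono n : n%:R^-1 * B n <= n%:R^-1 * A n by rewrite ler_wpM2l// invr_ge0.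
suff upper : forall e, 0 < e -> \forall n \near \oo, n%:R^-1 * A n < inf rates + e.
  exists (inf rates); split; apply/cvgrPdist_lt => e e0; near=> n.
  - have n0 : (0 < n)%N by near: n; exists 1%N.
    rewrite ler0_norm ?subr_le0 ?(le_trans (lower n n0))// opprB ltrBlDl.
    by near: n; exact: upper.
  - have n0 : (0 < n)%N by near: n; exists 1%N.
    rewrite ler0_norm ?subr_le0 ?lower// opprB ltrBlDl (le_lt_trans (mono n))//.
    by near: n; exact: upper.
move=> e e0; have e20 : 0 < e / 2 by rewrite divr_gt0.
have [_ [L _ <-] Llt] := inf_adherent e20 has_inf_rates.
have [k Ak] := Asub L; have [C AC] := subadditive_bound (B0 L) Ak.
near=> n.
have n0 : (0 < n)%N by near: n; exists 1%N.
have nR : 0 < n%:R :> R by rewrite ltr0n.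
rewrite [e]splitr addrA (@le_lt_trans _ _ (B L / L.+1%:R + C / n%:R))//.
  by rewrite ler_pdivrMl// mulrDr [n%:R * (C / _)]mulrC divfK ?gt_eqF.
rewrite ltrD// ltr_pdivrMr// -ltr_pdivrMl// mulrC.
by near: n; exact: nbhs_infty_gtr.
Unshelve. all: by end_near. Qed.

End GrowthRates.

(** * Entropy relative to a cover as a limit *)

Section TopologicalEntropyRates.
Variables (R : realType) (X : topologicalType) (f : X -> X).
Implicit Types (V : set (set X)) (W : set X) (L m n : nat).

Local Notation iterated_join V n := (join_upto n ((pullback f)^~ V)).

Lemma pullbackD V i j W :
  pullback f i V W -> pullback f (i + j) V (iter j f @^-1` W).
Proof.
move=> [W0 VW0 <-]; exists W0 => //.
by apply/seteqP; split=> x /=; rewrite iterD.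
Qed.

(** The join over times [0..m + L + 1] is the join over times [0..L] together
    with the join over [m + 1] further times seen from time [L + 1]. *)
Lemma iterated_join_split V L m W1 W2 :
    iterated_join V L W1 -> iterated_join V m W2 ->
  exists2 W, iterated_join V (m + L.+1) W & W1 `&` iter L.+1 f @^-1` W2 `<=` W.
Proof.
move=> [U1 VU1 <-] [U2 VU2 <-].
pose U i := if (i <= L)%N then U1 i else iter L.+1 f @^-1` U2 (i - L.+1)%N.
exists (\bigcap_(i in `I_(m + L.+1).+1) U i).
  exists U => // i im; rewrite /U; case: leqP => iL; first exact: VU1.
  rewrite -[X in pullback _ X](subnK iL); apply: pullbackD; apply: VU2.
  by rewrite leq_subLR addnC.
move=> x [U1x U2x] i /= im; rewrite /U; case: leqP => iL; first exact: U1x.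
by apply: U2x => /=; rewrite ltn_subLR// addnS addnC.
Qed.

Lemma iterated_join_covered V n k : covered_by setT V k ->
  exists k', covered_by setT (iterated_join V n) k'.
Proof.
move=> Vk; have W0k : covered_by setT (iterated_join V 0) k.
  apply: (covered_by_refine (phi := id) _ _ Vk) => // W0 VW0.
  exists (\bigcap_(i in `I_1) (iter i f @^-1` W0)).
    by exists (fun i => iter i f @^-1` W0) => // i _; exists W0.
  by move=> x [_ W0x] i /=; rewrite ltnS leqn0 => /eqP ->.
elim: n => [|n [k' IH]]; first by exists k.
exists (k * k')%N; apply: (covered_by_mul (phi1 := id) (phi2 := f) _ _ _ W0k IH) => //.
by move=> W1 W2 VW1 VW2; have := iterated_join_split VW1 VW2; rewrite addn1.
Qed.

Lemma iterated_join_ln_subadditive V k L m : covered_by setT V k ->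
  ln (covnum setT (iterated_join V (m + L.+1)))%:R <=
  ln (covnum setT (iterated_join V L))%:R +
  ln (covnum setT (iterated_join V m))%:R :> R.
Proof.
move=> Vk; apply: le_trans (ln_natM_le _ _ _); apply: ler_ln_nat.
have [[kL VL] [km Vm]] := (iterated_join_covered L Vk, iterated_join_covered m Vk).
apply: (covnum_mul (phi1 := id) (phi2 := iter L.+1 f) VL Vm) => // W1 W2.
exact: iterated_join_split.
Qed.

(** The defining limit of [cover_entropy] exists as soon as [V] has a finite
    subcover: subadditivity comes from [iterated_join_split]. *)
Lemma cover_entropy_cvg V k : covered_by setT V k ->
  (fun n => n%:R^-1 * ln (covnum setT (iterated_join V n))%:R : R) @ \oo -->
  cover_entropy R f V.
Proof.
move=> Vk; pose A n : R := ln (covnum setT (iterated_join V n))%:R.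
have [|//||c [Ac _]] := @subadditive_rates R A A.
- by move=> n; exact: ln_nat_ge0.
- by move=> L; exists 0%N => m _; exact: (iterated_join_ln_subadditive _ _ Vk).
- by rewrite /cover_entropy ((cvg_lim (@norm_hausdorff _ _) Ac)).
Qed.

(** Entropy is monotone under refinement even when [V] is refined only by a
    join of [V'] over a time window of fixed length: the window lengthens the
    words of [V'] by a constant, which multiplies the covering numbers by a
    bounded factor and disappears after division by [n]. *)
Lemma le_cover_entropy V V' L k : covered_by setT V' k ->
    (forall C, iterated_join V' L C -> exists2 W0, V W0 & C `<=` W0) ->
  cover_entropy R f V <= cover_entropy R f V'.
Proof.
move=> V'k refine; have [kL V'L] := iterated_join_covered L V'k.
have VkL : covered_by setT V kL.
  apply: (covered_by_refine (phi := id) _ _ V'L) => // C /refine[W0 VW0 CW0].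
  by exists W0 => // x [_ /CW0].
have refine_join n C : iterated_join V' (n + L.+1) C ->
    exists2 W, iterated_join V n W & C `<=` W.
  move=> [U V'U <-].
  have /choice[u uP] : forall i, exists W0, (i <= n + L.+1)%N ->
      V' W0 /\ U i = iter i f @^-1` W0.
    move=> i; case: (leqP i (n + L.+1)) => il; last by exists set0.
    by have [W0] := V'U i il; exists W0.
  have /choice[v vP] : forall i, exists W0, (i <= n)%N ->
      V W0 /\ \bigcap_(j in `I_L.+1) (iter j f @^-1` u (i + j)%N) `<=` W0.
    move=> i; case: (leqP i n) => il; last by exists set0.
    have [|W0 VW0 sub] :=
        refine (\bigcap_(j in `I_L.+1) (iter j f @^-1` u (i + j)%N)).
      exists (fun j => iter j f @^-1` u (i + j)%N) => // j jL.
      exists (u (i + j)%N) => //; apply: (uP _ _).1.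
      by rewrite leq_add// (leq_trans jL).
    by exists W0.
  (* the [V]-member at time [i] absorbs the [V']-members at times [i..i + L] *)
  exists (\bigcap_(i in `I_n.+1) (iter i f @^-1` v i)).
    by exists (fun i => iter i f @^-1` v i) => // i /vP[Vv _]; exists (v i).
  move=> x Ux i /= il; apply: (vP i il).2 => j /= jL.
  have ijL : (i + j <= n + L.+1)%N by rewrite leq_add// (leq_trans (ltnW jL)).
  by have := Ux (i + j)%N ijL; rewrite (uP _ ijL).2 /= addnC iterD.
have cvgV := cover_entropy_cvg VkL; have cvgV' := cover_entropy_cvg V'k.
have cvgL : (fun n => n%:R^-1 * ln (covnum setT (iterated_join V' L))%:R +
    n%:R^-1 * ln (covnum setT (iterated_join V' n))%:R : R) @ \oo -->
    0 + cover_entropy R f V'.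
  apply: cvgD cvgV'.
  rewrite -[X in _ --> X](mul0r (ln (covnum setT (iterated_join V' L))%:R)).
  apply: cvgMr_tmp; apply/gtr0_cvgV0; first by exists 1%N => // n /=; rewrite ltr0n.
  exact: cvgr_idn.
rewrite -[leRHS]add0r; apply: (ler_cvg_to cvgV cvgL); near=> n.
rewrite -mulrDr ler_wpM2l ?invr_ge0//.
apply: le_trans (iterated_join_ln_subadditive _ _ V'k); apply: ler_ln_nat.
have [k' V'k'] := iterated_join_covered (n + L.+1) V'k.
apply: (covnum_refine (phi := id) V'k') => // C /refine_join[W VW CW].
by exists W => // x [_ /CW].
Unshelve. all: by end_near. Qed.

End TopologicalEntropyRates.

(** * Compactness in the space of sequences *)

Section SequenceSpace.
Variable R : realType.
Local Notation seqs := {ptws nat -> R}.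
Local Notation I := (`[0, 1]%classic : set R).
Implicit Types (x y : seqs) (n m : nat).

(** A single parameter controls both the number of coordinates and the radius;
    these boxes form a neighbourhood basis ([nbhs_near_box],
    [near_box_basis]). *)
Definition near_box x n : set seqs :=
  [set y | forall j, (j <= n)%N -> `|x j - y j| < n.+1%:R^-1].

Lemma near_coord x j (P : set R) :
  (\forall t \near x j, P t) -> \forall y \near x, P (y j).
Proof. by move=> Pxj; have := @proj_continuous nat (fun=> R) j x _ Pxj. Qed.

Lemma nbhs_near_box x n : nbhs x (near_box x n).
Proof.
have : nbhs x [set y : seqs | forall j : 'I_n.+1, `|x j - y j| < n.+1%:R^-1].
  apply: (@filter_forall _ _ (fun (j : 'I_n.+1) (y : seqs) =>
    `|x j - y j| < n.+1%:R^-1) (nbhs x) _) => j.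
  apply: (@near_coord x j [set t | `|x j - t| < n.+1%:R^-1]).
  by apply: nbhsx_ballx; rewrite invr_gt0.
by apply: filterS => y xy j jn; have := xy (Ordinal (jn : (j < n.+1)%N)).
Qed.

Lemma near_box_le x m n : (m <= n)%N -> near_box x n `<=` near_box x m.
Proof.
move=> mn y xy j jm; rewrite (lt_le_trans (xy j _))//.
  exact: leq_trans mn.
by rewrite lef_pV2 ?posrE ?ltr0n// ler_nat.
Qed.

(** The filter generated by the boxes around [x] converges to [x]
    coordinatewise, hence in the product topology. *)
Lemma near_box_basis x (O : set seqs) : nbhs x O -> exists n, near_box x n `<=` O.
Proof.
have boxF : Filter (filter_from setT (near_box x)).
  apply: filter_from_filter; first by exists 0%N.
  move=> i j _ _; exists (maxn i j) => // y xy.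
  by split; apply: near_box_le xy; rewrite ?leq_maxl ?leq_maxr.
have boxcvg : {ptws, filter_from setT (near_box x) --> x}.
  apply/pointwise_cvgP => j; apply/cvgrPdist_lt => e e0.
  have [n _ ne] := near_infty_natSinv_lt (PosNum e0).
  exists (maxn n j) => // y xy /=.
  by rewrite (lt_trans (xy j (leq_maxr _ _)))// ne//= leq_maxl.
by move=> /boxcvg[n _ nO]; exists n.
Qed.

(** The index is chosen so that [n.*2.+2 = 2 * n.+1], which halves the
    radius. *)
Lemma near_box_trans x n x' y :
  near_box x n.*2.+1 x' -> near_box x' n.*2.+1 y -> near_box x n y.
Proof.
move=> xx' x'y j jn; have jn2 : (j <= n.*2.+1)%N.
  by rewrite (leq_trans jn)// -addnn -addnS leq_addr.
have -> : n.+1%:R^-1 = n.*2.+2%:R^-1 + n.*2.+2%:R^-1 :> R.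
  have -> : n.*2.+2%:R = n.+1%:R * 2 :> R by rewrite -doubleS -muln2 natrM.
  by rewrite invfM -splitr.
by rewrite (le_lt_trans (ler_distD (x' j) _ _))// ltrD ?xx' ?x'y.
Qed.

Definition unit_seqs : set seqs := [set x | forall j, I (x j)].

Lemma unit_seqs_compact : compact unit_seqs.
Proof.
by apply: (@tychonoff nat (fun=> R) (fun=> I)) => _; exact: segment_compact.
Qed.

Section ClosedRelation.
Variable G : set (R * R).
Hypothesis G_closed : closed G.

(** The finite words of [star G n], with free letters appended, so that all
    lengths live in one compact space and decrease to [star_infty G]. *)
Definition star_prefix n : set seqs :=
  [set x | unit_seqs x /\ forall i, (i < n)%N -> G (x i, x i.+1)].

(** A sequence outside [star_infty G] has a forbidden transition, and the
    transition at the same place stays forbidden nearby since [G] is closed. *)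
Lemma near_not_star x : unit_seqs x -> ~ star_infty G x ->
  exists i, \forall y \near x, ~ G (y i, y i.+1).
Proof.
move=> xI nGx; have [i Gi] : exists i, ~ G (x i, x i.+1).
  by apply/existsNP => Gx; apply: nGx; split.
have : nbhs (x i, x i.+1) (~` G).
  by apply: open_nbhs_nbhs; split => //; rewrite openC.
move=> [[A B] [/= Axi Bxi] AB]; exists i.
have yA : \forall y \near x, A (y i) by exact: near_coord.
have yB : \forall y \near x, B (y i.+1) by exact: near_coord.
by apply: (@filterS2 _ (nbhs x) (nbhs_filter x) _ _ _ _ yA yB) => y Ay By;
  exact: (AB (y i, y i.+1)).
Qed.

(** Finite words long enough look, in their initial part, like infinite
    ones.  Each point of the cube is either in [star_infty G], hence locally in
    [O], or has locally a forbidden transition at a fixed place; compactness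
    makes the length uniform. *)
Lemma star_prefix_sub_nbhs (O : set seqs) :
    (forall x, star_infty G x -> \forall y \near x, unit_seqs y -> O y) ->
  exists n, star_prefix n `<=` O.
Proof.
move=> GO; suff : \forall n \near \oo, unit_seqs `<=` (fun x => star_prefix n x -> O x).
  by move=> [n _ nO]; exists n => x Ex; apply: (nO n) => //=; case: Ex.
apply: (compact_near_coveringP _).1; first exact: unit_seqs_compact.
move=> x xI; have [Gx|nGx] := pselect (star_infty G x).
  have Oy := GO x Gx.
  by near=> y n => -[yI _]; apply: (near Oy y).
have [i Ni] := near_not_star xI nGx.
near=> y n => -[_ Gy].
have ni : (i < n)%N by near: n; exact: nbhs_infty_gt.
have nGy : ~ G (y i, y i.+1) by near: y.
by have := Gy i ni.
Unshelve. all: by end_near. Qed.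

(** A Lebesgue number for open covers of [star_infty G], again by compactness
    of the whole cube; points outside [star_infty G] are harmless because [x]
    and all points near it violate a transition. *)
Lemma lebesgue_box (V : set (set (star_infty G))) : open_cover V ->
  exists n, forall x : star_infty G, exists2 W, V W &
    forall y : star_infty G, near_box (\val x) n (\val y) -> W y.
Proof.
move=> [Vopen Vcov].
suff : \forall n \near \oo, unit_seqs `<=` (fun x => star_infty G x ->
    exists2 W, V W & forall y : star_infty G, near_box x n (\val y) -> W y).
  move=> [n _ nV]; exists n => x; have Gx := set_valP x.
  by apply: (nV n) => //=; case: Gx.
apply: (compact_near_coveringP _).1; first exact: unit_seqs_compact.
move=> x xI; have [Gx|nGx] := pselect (star_infty G x); last first.
  have [i Ni] := near_not_star xI nGx.
  near=> y n => -[_ Gy].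
  have nGy : ~ G (y i, y i.+1) by near: y.
  by have := Gy i.
have [W VW Wx] := Vcov (SigSub (mem_set Gx)) Logic.I.
have [Q Qopen QW] := Vopen _ VW.
have [n nO] : exists n, near_box x n `<=` Q.
  apply: near_box_basis; apply: open_nbhs_nbhs; split => //.
  by move: Wx; rewrite -QW.
near=> x' m => _.
have xx' : near_box x n.*2.+1 x' by near: x'; exact: nbhs_near_box.
have nm : (n.*2.+1 <= m)%N by near: m; exact: nbhs_infty_ge.
exists W => // y x'y; rewrite -QW; apply: nO.
by apply: (near_box_trans xx'); exact: near_box_le x'y.
Unshelve. all: by end_near. Qed.

End ClosedRelation.
End SequenceSpace.

(** * Minimal interval covers of small mesh *)

Section SmallCovers.
Variable R : realType.
Local Notation I := (`[0, 1]%classic : set R).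

(** Equally spaced intervals of length [n.+1%:R^-1] cover the interval; among
    all their finite subfamilies that cover, one of least cardinality is
    minimal. *)
Lemma exists_small_minimal_cover n : exists2 a : set (set R),
  minimal_interval_cover a &
  forall W, a W -> forall s t, W s -> W t -> `|s - t| < n.+1%:R^-1.
Proof.
pose d : R := n.+1%:R^-1 / 2; have d0 : 0 < d by rewrite divr_gt0// invr_gt0.
pose J (i : nat) : set R := `](i%:R - 1) * d, (i%:R + 1) * d[%classic `&` I.
have J_interval i : open_interval_in_I (J i).
  split; last by exists `](i%:R - 1) * d, (i%:R + 1) * d[%classic => //;
    exact: itv_open.
  move=> s t [sJ sI] [tJ tI] u sut.
  by split; [exact: interval_is_interval sJ tJ _ sut|
             exact: interval_is_interval sI tI _ sut].
have J_small i s t : J i s -> J i t -> `|s - t| < n.+1%:R^-1.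
  rewrite /J /= !in_itv/= => -[/andP[s1 s2] _] [/andP[t1 t2] _].
  by rewrite ltr_norml; apply/andP; split; rewrite (splitr n.+1%:R^-1) -/d; lra.
pose M := (Num.trunc (d^-1)).+1.
have Jcov : covered_by I (range J) M.
  exists J; first by move=> i _; exists i.
  move=> t /=; rewrite in_itv/= => /andP[t0 t1].
  have td0 : 0 <= t / d by rewrite divr_ge0// ltW.
  have /andP[td1 td2] := truncn_itv td0.
  exists (Num.trunc (t / d)) => /=.
    by rewrite ltnS le_truncn// -[leRHS]mul1r ler_wpM2r// ?invr_ge0 ltW.
  split; last by rewrite /= in_itv/= t0.
  rewrite /= in_itv/= -[_ * d < t]ltr_pdivlMr// -[t < _]ltr_pdivrMr// natr1 td2 andbT.
  by rewrite ltrBlDr (le_lt_trans td1)// ltrDl.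
have [N_cov _] := covnumP Jcov.
have [k kN kcov] := covered_coverable N_cov.
have Nk : k = covnum I (range J).
  apply/eqP; rewrite eqn_leq kN/=.
  exact: (covnumP (coverable_covered kcov)).2.
have [a [aJ ak acov]] := kcov.
exists a; last by move=> W /aJ[i _ <-]; exact: J_small.
have afin : finite_set a by apply/finite_setP; exists k.
split => //; first by move=> W /aJ[i _ <-].
move=> b ba /negP nab bcov; apply: nab.
have /finite_setP[l bl] := sub_finite_set ba afin.
rewrite (card_le_eql ak) (card_le_eqr bl) card_le_II Nk.
apply: (covnumP (coverable_covered _)).2.
by exists b; split => //; exact: subset_trans aJ.
Qed.

End SmallCovers.

(** * Entropy of a closed relation and of its shift *)

Section EntropyOfClosedRelation.
Variables (R : realType) (G : set (R * R)).
Hypothesis G_closed : closed G.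
Local Notation seqs := {ptws nat -> R}.
Local Notation I := (`[0, 1]%classic : set R).
Local Notation iterated_join V n := (join_upto n ((pullback (shift_map G))^~ V)).
Implicit Types (x y : seqs) (a : set (set R)) (n m : nat).

Definition cylinders a n : set (set seqs) :=
  [set [set x | forall j, (j <= n)%N -> k j (x j)]
     | k in [set k : nat -> set R | forall j, (j <= n)%N -> a (k j)]].

Definition first_coordinate_cover a : set (set (star_infty G)) :=
  [set [set x | W (\val x 0%N)] | W in a].

Lemma iter_seq_shift i x j : iter i seq_shift x j = x (j + i)%N.
Proof. by elim: i j => [|i IH] j /=; rewrite ?addn0// /seq_shift IH addSnnS. Qed.

Lemma val_iter_shift i (x : star_infty G) :
  \val (iter i (shift_map G) x) = iter i seq_shift (\val x).
Proof. by elim: i => [//|i IH] /=; rewrite -IH. Qed.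

(** Time [i] of the shift reads coordinate [i], so the iterated joins of the
    induced cover are the traces of the cylinders on [star_infty G]. *)
Lemma join_first_coordinate_cover a n C :
  iterated_join (first_coordinate_cover a) n C <->
  exists2 D, cylinders a n D & C = \val @^-1` D.
Proof.
split.
  move=> [U aU <-].
  have /choice[k kP] : forall i, exists W, (i <= n)%N ->
      a W /\ U i = [set x | W (\val x i)].
    move=> i; case: (leqP i n) => il; last by exists set0.
    have [_ [W aW <-] UW] := aU i il; exists W => _; split => //.
    by rewrite -UW; apply/seteqP; split=> x /=; rewrite val_iter_shift iter_seq_shift.
  exists [set x | forall j, (j <= n)%N -> k j (x j)].
    by exists k => // j /kP[].
  apply/seteqP; split=> x xU j jn.
    by have := xU j jn; rewrite (kP j jn).2.
  by rewrite (kP j jn).2; exact: xU.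
move=> [_ [k ak <-] ->].
exists (fun i => [set x | k i (\val x i)]).
  move=> i il; exists [set x | k i (\val x 0%N)].
    by exists (k i) => //; exact: ak.
  by apply/seteqP; split=> x /=; rewrite val_iter_shift iter_seq_shift.
by apply/seteqP; split=> x xU j jn; exact: xU.
Qed.

Lemma cylinders_split a L m W1 W2 : cylinders a L W1 -> cylinders a m W2 ->
  exists2 W, cylinders a (m + L.+1) W & W1 `&` iter L.+1 seq_shift @^-1` W2 `<=` W.
Proof.
move=> [k1 ak1 <-] [k2 ak2 <-].
pose k i := if (i <= L)%N then k1 i else k2 (i - L.+1)%N.
exists [set x | forall j, (j <= m + L.+1)%N -> k j (x j)].
  exists k => // i im; rewrite /k; case: leqP => iL; first exact: ak1.
  by apply: ak2; rewrite leq_subLR addnC.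
move=> x [U1x U2x] i /= im; rewrite /k; case: leqP => iL; first exact: U1x.
by have := U2x (i - L.+1)%N; rewrite iter_seq_shift subnK// leq_subLR addnC; exact.
Qed.

Lemma star_prefix_covered a p n : covered_by I a p ->
  exists k, covered_by (star_prefix G n) (cylinders a n) k.
Proof.
move=> acov.
have cov0 m : covered_by (star_prefix G m) (cylinders a 0) p.
  apply: (covered_by_refine (phi := fun x => x 0%N) _ _ acov).
    by move=> x [xI _]; exact: xI.
  move=> W aW; exists [set x | forall j, (j <= 0)%N -> W (x j)].
    by exists (fun=> W).
  by move=> x [_ Wx] j /=; rewrite leqn0 => /eqP ->.
elim: n => [|n [k IH]]; first by exists p.
exists (p * k)%N.
apply: (covered_by_mul (phi1 := id) (phi2 := seq_shift) _ _ _ (cov0 n.+1) IH) => //.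
  move=> x [xI xG]; split=> i; first exact: xI.
  by move=> ilt; exact: xG.
by move=> W1 W2 aW1 aW2; have := cylinders_split aW1 aW2; rewrite addn1.
Qed.

Lemma first_coordinate_covered a p : covered_by I a p ->
  covered_by setT (first_coordinate_cover a) p.
Proof.
move=> acov.
apply: (covered_by_refine (phi := fun x : star_infty G => val x 0%N) _ _ acov).
  by move=> x _; have [xI _] := set_valP x; exact: xI.
by move=> W aW; exists [set x | W (\val x 0%N)]; [exists W | move=> x []].
Qed.

(** Truncating a sequence and extending a word (by its first letter) compare
    the two sets in both directions, and match boxes with cylinders. *)
Lemma covnum_star_prefix a p m : covered_by I a p ->
  covnum (star G m) (boxes a m) = covnum (star_prefix G m) (cylinders a m).
Proof.
move=> acov; have [k cov] := star_prefix_covered m acov.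
pose ext (x : 'I_m.+1 -> R) : seqs := fun j => x (inord j).
have ext_in (x : 'I_m.+1 -> R) : star G m x -> star_prefix G m (ext x).
  move=> [xI xG]; split=> [j|i im]; first exact: (xI (inord j)).
  have -> : ext x i = x (widen_ord (leqnSn m) (Ordinal im)).
    by congr (x _); apply: val_inj; rewrite /= inordK// ltnS ltnW.
  have -> : ext x i.+1 = x (lift ord0 (Ordinal im)).
    by congr (x _); apply: val_inj; rewrite /= inordK.
  exact: xG.
have ext_box D : cylinders a m D ->
    exists2 W, boxes a m W & star G m `&` ext @^-1` D `<=` W.
  move=> [c ac <-]; exists [set x : 'I_m.+1 -> R | forall j : 'I_m.+1, c j (x j)].
    by exists (fun j : 'I_m.+1 => c j) => // j; apply: ac; rewrite -ltnS.
  move=> x [_ xc] j; have := xc j; rewrite /ext inord_val; apply.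
  by rewrite -ltnS.
apply/eqP; rewrite eqn_leq; apply/andP; split.
  exact: (covnum_refine cov ext_in ext_box).
apply: (covnum_refine (phi := fun (x : seqs) (j : 'I_m.+1) => x j)
  (covered_by_refine ext_in ext_box cov)).
  by move=> x [xI xG]; split=> [j|i]; [exact: xI|exact: (xG i)].
move=> _ [c ac <-]; exists [set x | forall j, (j <= m)%N -> c (inord j) (x j)].
  by exists (fun j => c (inord j)) => // j _; exact: ac.
by move=> x [_ xc] j jm; have := xc (inord j); rewrite inordK.
Qed.

(** The key estimate: the first [L + 1] letters of a word are counted by
    covers of [star_infty G] rather than of the finite words.  This is possible
    because an optimal family of cylinders covering [star_infty G] covers a
    neighbourhood of it, hence all sequences with [k] allowed transitions; the
    sequences at hand have [m + L + 1 >= k] of them. *)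
Lemma covnum_star_prefix_split a p L : covered_by I a p ->
    (forall W, a W -> exists2 O : set R, open O & W = O `&` I) ->
  exists k, forall m, (k <= m)%N ->
    (covnum (star_prefix G (m + L.+1)) (cylinders a (m + L.+1)) <=
     covnum setT (iterated_join (first_coordinate_cover a) L) *
     covnum (star_prefix G m) (cylinders a m))%N.
Proof.
move=> acov aopen.
have [q /covnumP[[c cP ccov] _]] :=
  iterated_join_covered (shift_map G) L (first_coordinate_covered acov).
set N := covnum setT _ in cP ccov *.
have /choice[D DP] : forall i, exists D, (i < N)%N ->
    cylinders a L D /\ c i = \val @^-1` D.
  move=> i; case: (ltnP i N) => iN; last by exists set0.
  by have [D aD cD] := (join_first_coordinate_cover _ _ _).1 (cP i iN); exists D.
pose O := \bigcup_(i in `I_N) D i.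
have Onear x : star_infty G x -> \forall y \near x, unit_seqs y -> O y.
  move=> Gx; have [i iN ci] := ccov (SigSub (mem_set Gx)) Logic.I.
  have [[k ak kD] cD] := DP i iN.
  have xk j : (j <= L)%N -> k j (x j) by move: ci; rewrite cD -kD; exact.
  have near_k : nbhs x
      [set y : seqs | forall j : 'I_L.+1, unit_seqs y -> k j (y j)].
    apply: (@filter_forall _ _ (fun (j : 'I_L.+1) (y : seqs) =>
      unit_seqs y -> k j (y j)) (nbhs x) _) => j.
    have jL : (j <= L)%N by rewrite -ltnS.
    have [Q Qopen kQ] := aopen _ (ak j jL).
    have := xk j jL; rewrite kQ => -[Qx _].
    have : nbhs x [set y : seqs | Q (y j)].
      by apply: (@near_coord R x j Q); exact: open_nbhs_nbhs.
    by apply: filterS => y Qy yI; split.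
  apply: filterS near_k => y ky yI; exists i => //; rewrite -kD => j jL.
  by have := ky (Ordinal (jL : (j < L.+1)%N)); apply.
have [k Ek] := star_prefix_sub_nbhs G_closed Onear.
exists k => m km; have [l mcov] := star_prefix_covered m acov.
have [mcov' _] := covnumP mcov.
have Ocov : covered_by O (cylinders a L) N by exists D => // i /DP[].
apply: (covnumP (covered_by_mul (phi1 := id) (phi2 := iter L.+1 seq_shift)
  _ _ _ Ocov mcov')).2.
- move=> x [xI xG]; apply: Ek; split => // i ik; apply: xG.
  by rewrite (leq_trans ik)// (leq_trans km)// leq_addr.
- move=> x [xI xG]; split=> i; first by rewrite iter_seq_shift; exact: xI.
  move=> im; rewrite !iter_seq_shift addSn; apply: xG.
  by rewrite ltn_add2r.
- by move=> W1 W2; exact: cylinders_split.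
Qed.

(** The dead ends do not contribute: covers of the finite words and covers of
    [star_infty G] have the same growth rate. *)
Lemma ent_cover_eq a p : star_infty G !=set0 -> covered_by I a p ->
    (forall W, a W -> exists2 O : set R, open O & W = O `&` I) ->
  ent_cover G a = cover_entropy R (shift_map G) (first_coordinate_cover a).
Proof.
move=> /set0P/negbTE G0 acov aopen; rewrite /ent_cover G0.
under [X in limn X]funext => m do rewrite (covnum_star_prefix m acov).
have fcov := first_coordinate_covered acov.
pose A m : R := ln (covnum (star_prefix G m) (cylinders a m))%:R.
pose B m : R := ln (covnum setT (iterated_join (first_coordinate_cover a) m))%:R.
have [||L|c [Ac Bc]] := @subadditive_rates R A B.
- by move=> n; exact: ln_nat_ge0.
- move=> n; apply: ler_ln_nat; have [k cov] := star_prefix_covered n acov.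
  apply: (covnum_refine (phi := \val) cov).
    by move=> x _; have [xI xG] := set_valP x; split.
  move=> D aD; exists (\val @^-1` D); last by move=> x [].
  by apply/join_first_coordinate_cover; exists D.
- have [k kP] := covnum_star_prefix_split L acov aopen.
  exists k => m km; apply: le_trans (ln_natM_le _ _ _).
  exact: ler_ln_nat (kP m km).
- by rewrite /cover_entropy (cvg_lim (@norm_hausdorff _ _) Ac)
    (cvg_lim (@norm_hausdorff _ _) Bc).
Qed.

Lemma minimal_interval_cover_covered a :
  minimal_interval_cover a -> exists p, covered_by I a p.
Proof.
move=> [/finite_setP[p ap] _ acov _]; exists p; apply: coverable_covered.
by exists a; split.
Qed.

Lemma first_coordinate_cover_open a : minimal_interval_cover a ->
  open_cover (first_coordinate_cover a).
Proof.
move=> [_ aI acov _]; split.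
  move=> _ [W /aI[_ [Q Qopen ->]] <-].
  exists ((fun x : seqs => x 0%N) @^-1` Q).
    apply: open_comp => // x _; exact: (@proj_continuous nat (fun=> R) 0%N).
  apply/seteqP; split=> x /=; last by case.
  by move=> Ox; split => //; have [xI _] := set_valP x; exact: xI.
move=> x _; have [xI _] := set_valP x; have [W aW Wx] := acov _ (xI 0%N).
by exists [set y | W (\val y 0%N)] => //; exists W.
Qed.

(** If the intervals are shorter than the Lebesgue number, a cylinder meeting
    [star_infty G] stays in a near box of any of its points; an empty trace is
    contained in any member of [V]. *)
Lemma exists_refining_cover V : star_infty G !=set0 ->
    open_cover V ->
  exists2 a, minimal_interval_cover a &
    cover_entropy R (shift_map G) V <=
    cover_entropy R (shift_map G) (first_coordinate_cover a).
Proof.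
move=> [x0 Gx0] Vopen; have [n nV] := lebesgue_box G_closed Vopen.
have [a amin asmall] := exists_small_minimal_cover R n; exists a => //.
have [p acov] := minimal_interval_cover_covered amin.
apply: (le_cover_entropy R (L := n) (first_coordinate_covered acov)) => C.
move=> /join_first_coordinate_cover[_ [k ak <-] ->].
set C' := _ @^-1` _.
have [[x Cx]|C0] := pselect (C' !=set0); last first.
  have [W VW _] := nV (SigSub (mem_set Gx0)); exists W => // y Cy.
  by case: C0; exists y.
have [W VW xW] := nV x; exists W => // y Cy; apply: xW => j jn.
exact: (asmall _ (ak j jn) _ _ (Cx j jn) (Cy j jn)).
Qed.

End EntropyOfClosedRelation.
Arguments first_coordinate_cover {R} G a _.

Theorem theorem9 (R : realType) (G : set (R * R))
    (G_sub : G `<=` `[0, 1]%classic `*` `[0, 1]%classic)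
    (G_closed : closed G)
    (G_neq0 : star_infty G !=set0)
    (G_shift : seq_shift @` star_infty G = star_infty G) :
  ent G = top_entropy R (shift_map G).
Proof.
have ent_eq a : minimal_interval_cover a -> ent_cover G a =
    cover_entropy R (shift_map G) (first_coordinate_cover G a).
  move=> amin; have [p acov] := minimal_interval_cover_covered amin.
  by apply: (ent_cover_eq G_closed G_neq0 acov) => W;
    case: amin => _ + _ _ => /[apply] -[].
apply/eqP; rewrite eq_le; apply/andP; split; apply: ge_ereal_sup.
  move=> _ [a amin <-]; rewrite ent_eq//; apply: ereal_sup_ubound.
  by exists (first_coordinate_cover G a) => //; exact: first_coordinate_cover_open.
move=> _ [V Vopen <-].
have [a amin Va] := exists_refining_cover G_closed G_neq0 Vopen.
apply: (@le_trans _ _ (ent_cover G a)%:E); first by rewrite ent_eq// lee_fin.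
by apply: ereal_sup_ubound; exists a.
Qed.
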